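(* Let $R$ be a unital associative semiprime ring and $n$ a nonnegative integer. For an element $a \in R$ the following conditions are equivalent: (1) $\operatorname{rank} a = n$; (2) $\operatorname{rank} a$ is greater than $n-1$ (possibly infinite), and for every $r \in R$ either $\operatorname{rank}(ar) < n$ or there exists $x \in \mathcal{U}(R)$ such that $ar = ax$.
   Context: For a unital associative ring $R$, $\mathcal{U}(R)$ denotes the group of multiplicatively invertible elements of $R$. The right rank of an element $a \in R$ is the least nonnegative integer $k$ such that $a$ is contained in a sum of $k$ minimal right ideals of $R$, with the convention that the sum of zero minimal right ideals is $0$; if no such integer exists, the right rank of $a$ is infinite. The left rank is defined analogously using minimal left ideals. In a semiprime ring the left and right rank of every element coincide, and the common value is denoted $\operatorname{rank} a$ and called the rank of $a$. *)

(* Defs.v *)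
From HB Require Import structures.
From mathcomp Require Import all_boot all_order all_algebra.
From mathcomp Require Import boolp classical_sets constructive_ereal.

Set Implicit Arguments.
Unset Strict Implicit.
Unset Printing Implicit Defensive.

Import Order.TTheory GRing.Theory Num.Theory.
Local Open Scope classical_set_scope.
Local Open Scope ring_scope.

(* [pzRingType]: unital associative, not necessarily commutative, and the
   zero ring is allowed. *)

Definition units (R : pzRingType) : set R :=
  [set x | exists y : R, x * y = 1 /\ y * x = 1].
Arguments units R : clear implicits.

Definition semiprime_ring (R : pzRingType) : Prop :=
  forall a : R, (forall x : R, a * x * a = 0) -> a = 0.

Definition right_ideal (R : pzRingType) (I : set R) : Prop :=
  [/\ I 0,
      forall x y : R, I x -> I y -> I (x + y) &
      forall x r : R, I x -> I (x * r)].

Definition minimal_right_ideal (R : pzRingType) (I : set R) : Prop :=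
  [/\ right_ideal I, I <> [set 0] &
      forall J : set R,
        right_ideal J -> J `<=` I -> J = [set 0] \/ J = I].

Definition ideal_sum (R : pzRingType) (k : nat) (I : 'I_k -> set R) : set R :=
  [set a | exists2 u : 'I_k -> R, forall i, I i (u i) & a = \sum_(i < k) u i].

Definition in_sum_of_minimal (R : pzRingType) (a : R) (k : nat) : Prop :=
  exists2 I : 'I_k -> set R,
    forall i, minimal_right_ideal (I i) & ideal_sum I a.

Lemma ex_in_sum_of_minimal (R : pzRingType) (a : R) :
  (exists k, in_sum_of_minimal a k) -> exists k, `[< in_sum_of_minimal a k >].
Proof. by move=> [k ak]; exists k; apply/asboolP. Qed.

(* Equivalent form of semiprimeness: no nonzero two-sided ideal squares to 0. *)
Lemma semiprime_ringP (R : pzRingType) :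
  semiprime_ring R <->
  forall I : set R,
    right_ideal I -> (forall r x : R, I x -> I (r * x)) ->
    (forall x y : R, I x -> I y -> x * y = 0) -> I = [set 0].
Proof.
split=> [sp I [I0 ID IM] MI I2|sp a aRa].
  apply/seteqP; split=> [x Ix|_ -> //].
  by apply: sp => y; apply: I2 => //; exact: IM.
pose ideal (I : set R) := right_ideal I /\ forall r x : R, I x -> I (r * x).
pose I := [set x | forall J, ideal J -> J a -> J x].
have Imin J : ideal J -> J a -> I `<=` J by move=> iJ Ja x; apply.
have annl x : I x -> forall r, a * r * x = 0.
  apply: (Imin [set y | forall r, a * r * y = 0]) => //; split=> [|s y ay r]; last by rewrite !mulrA -[a * r * s]mulrA ay.
  split=> [r|y z ay az r|y s ay r]; first by rewrite mulr0.
  - by rewrite mulrDr ay az addr0.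
  - by rewrite mulrA ay mul0r.
have annr x : I x -> forall y, I y -> forall r, y * r * x = 0.
  move=> Ix; apply: (Imin [set y | forall r, y * r * x = 0]); last exact: annl.
  split=> [|s y ay r]; last by rewrite -!mulrA [y * _]mulrA ay mulr0.
  split=> [r|y z ay az r|y s ay r]; first by rewrite !mul0r.
  - by rewrite !mulrDl ay az addr0.
  - by rewrite -[y * s * r]mulrA ay.
have IE : I = [set 0].
  apply: sp.
  - split=> [J [[]] //|x y Ix Iy J iJ Ja|x r Ix J iJ Ja].
    + by case: (iJ) => [[_ JD _] _]; apply: JD; [exact: Ix|exact: Iy].
    + by case: (iJ) => [[_ _ JM] _]; apply: JM; exact: Ix.
  - by move=> r x Ix J iJ Ja; case: (iJ) => _; apply; exact: Ix.
  - by move=> x y Ix Iy; have := annr _ Iy _ Ix 1; rewrite mulr1.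
by have : I a by []; rewrite IE.
Qed.

(* Ranks are extended integers, so that [n - 1] makes sense for [n = 0]. *)
Definition right_rank (R : pzRingType) (a : R) : \bar int :=
  if pselect (exists k, in_sum_of_minimal a k) is left exk
  then ((ex_minn (ex_in_sum_of_minimal exk))%:Z)%:E
  else +oo%E.

(* The left ideals of [R] are the right ideals of the opposite ring [R^c]. *)
Definition left_rank (R : pzRingType) (a : R) : \bar int :=
  right_rank (a : R^c).

(* Meaningful for semiprime [R]: see [left_rank_right_rank] below. *)
Definition rank (R : pzRingType) (a : R) : \bar int := right_rank a.

Lemma right_rank_le (R : pzRingType) (a : R) (k : nat) :
  in_sum_of_minimal a k -> (right_rank a <= k%:Z%:E)%E.
Proof.
move=> ak; rewrite /right_rank; case: pselect => [exk|[]]; last by exists k.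
by case: ex_minnP => m _ /(_ k); rewrite lee_fin lez_nat; apply; apply/asboolP.
Qed.

Lemma le_right_rank (R S : pzRingType) (a : R) (b : S) :
  (forall k, in_sum_of_minimal b k ->
     exists2 m, (m <= k)%N & in_sum_of_minimal a m) ->
  (right_rank a <= right_rank b)%E.
Proof.
move=> ab; rewrite {2}/right_rank; case: pselect => [exk|_]; last by rewrite leey.
case: ex_minnP => k /asboolP /ab[m mk /right_rank_le am] _.
by apply: le_trans am _; rewrite lee_fin lez_nat.
Qed.

Lemma semiprime_converse (R : pzRingType) :
  semiprime_ring R -> semiprime_ring R^c.
Proof.
move=> sp a aRa; apply: sp => x; rewrite -mulrA; exact: aRa.
Qed.

Definition principal_left_ideal (R : pzRingType) (a : R) : set R^c :=
  [set y | exists r : R, y = r * a].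

Lemma minimal_left_ideal_gen (R : pzRingType) (I : set R) (z : R) :
  semiprime_ring R -> minimal_right_ideal I -> I z -> z <> 0 ->
  minimal_right_ideal (principal_left_ideal z).
Proof.
move=> sp [[I0 ID IM] _ Imin] Iz z0.
have divides (y : R) : y * z <> 0 -> exists v, z = v * (y * z).
  move=> yz0.
  have [s yzs0] : exists s, y * z * s * (y * z) <> 0.
    by apply: contrapT => nex; apply/yz0/sp => x; apply: contrapT => ne;
       apply: nex; exists x.
  set u := z * s * y; have Iu : I u by rewrite /u -mulrA; exact: IM.
  have uz0 : u * z <> 0.
    by move=> uz; apply: yzs0; rewrite -[RHS](mulr0 y) -uz /u !mulrA.
  have uinj x : I x -> u * x = 0 -> x = 0.
    pose J := [set x | I x /\ u * x = 0]%classic.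
    have [] := Imin J.
    - split; first by split=> //; rewrite mulr0.
      + by move=> x1 x2 [? e1] [? e2]; split; [exact: ID|rewrite mulrDr e1 e2 addr0].
      + by move=> x1 r [? e1]; split; [exact: IM|rewrite mulrA e1 mul0r].
    - by move=> x1 [].
    - by move=> JE Ix ux; have : J x by []; rewrite JE.
    - by move=> JE; move: Iz; rewrite -JE => -[].
  have usurj x : I x -> exists2 w, I w & x = u * w.
    pose J := [set x | exists2 w, I w & x = u * w]%classic.
    have [] := Imin J.
    - split; first by exists 0; rewrite ?mulr0.
      + by move=> _ _ [w1 ? ->] [w2 ? ->]; exists (w1 + w2); rewrite ?mulrDr //; exact: ID.
      + by move=> _ r [w ? ->]; exists (w * r); rewrite ?mulrA //; exact: IM.
    - by move=> _ [w ? ->]; exact: IM.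
    - move=> JE; have : J (u * z) by exists z.
      by rewrite JE => /uz0.
    - by move=> JE Ix; have Jx : J x; [by rewrite JE|exact: Jx].
  have IN x : I x -> I (- x) by move=> /(IM _ (- 1)); rewrite mulrN1.
  have [e Ie ue] := usurj _ Iu.
  have eI x : I x -> e * x = x.
    move=> Ix; apply/eqP; rewrite -subr_eq0; apply/eqP/uinj.
      by apply: ID; [exact: IM|exact: IN].
    by rewrite mulrBr mulrA -ue subrr.
  have [w Iw ew] := usurj _ Ie.
  have wu : w * u = e.
    apply/eqP; rewrite -subr_eq0; apply/eqP/uinj.
      by apply: ID; [exact: IM|exact: IN].
    by rewrite mulrBr mulrA -ew eI // -ue subrr.
  exists (w * (z * s)); rewrite -{1}(eI _ Iz) -wu /u.
  by rewrite !mulrA.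
split.
- split; first by exists 0; rewrite mul0r.
  + by move=> _ _ [r ->] [t ->]; exists (r + t); rewrite mulrDl.
  + by move=> _ t [r ->]; exists ((t : R) * r); rewrite -mulrA.
- move=> E; apply: z0; have : principal_left_ideal z z.
    by exists 1; rewrite mul1r.
  by rewrite E.
- move=> J [J0 JD JM] Jz.
  have [sub|nsub] := pselect (J `<=` [set 0]).
    by left; apply/seteqP; split=> // _ ->.
  right; apply/seteqP; split=> // _ [r ->].
  have [x [Jx x0]] : exists x, J x /\ x <> 0.
    by apply: contrapT => nex; apply: nsub => x Jx; apply: contrapT => x0;
       apply: nex; exists x.
  have [y xE] := Jz _ Jx; rewrite xE in Jx x0.
  have [v ->] := divides _ x0; rewrite mulrA.
  exact: (JM (y * z) (r * v)).
Qed.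

Lemma left_rank_le_right_rank (R : pzRingType) (a : R) :
  semiprime_ring R -> (left_rank a <= right_rank a)%E.
Proof.
move=> sp; apply: le_right_rank => k [I Imin [u Iu ->]].
pose A : {set 'I_k} := [set i | u i != 0]%SET.
exists #|A|; first by rewrite -[leqRHS]card_ord max_card.
exists (fun i => principal_left_ideal (u (enum_val i))).
  move=> i; apply: (minimal_left_ideal_gen sp (Imin _) (Iu _)).
  by have := enum_valP i; rewrite inE => /eqP.
exists (fun i => u (enum_val i)); first by move=> i; exists 1; rewrite mul1r.
rewrite (bigID (mem A)) /= [X in _ + X]big1 ?addr0 => [|i].
  exact: big_enum_val.
by rewrite inE negbK => /eqP.
Qed.

Lemma left_rank_right_rank (R : pzRingType) (a : R) :
  semiprime_ring R -> left_rank a = right_rank a.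
Proof.
move=> sp; apply/eqP; rewrite eq_le left_rank_le_right_rank //=.
apply: le_trans (@left_rank_le_right_rank R^c a (semiprime_converse sp)).
by apply: le_right_rank => k ak; exists k.
Qed.

(* Main.v *)
Require Import Defs.
From mathcomp Require Import all_boot all_order all_algebra.
From mathcomp Require Import boolp classical_sets constructive_ereal.

Set Implicit Arguments.
Unset Strict Implicit.
Unset Printing Implicit Defensive.

Import Order.TTheory GRing.Theory Num.Theory.
Local Open Scope ring_scope.

(** Everything is reduced to orthogonal families of minimal idempotents.
    Write [orth_sum f m] when [f] is a sum of [m] such idempotents.  A
    Steinitz exchange shows that [f] then has rank exactly [m]
    ([orth_sum_le_rank]).  Semiprimeness enters twice: a minimal right ideal
    contains a nonzero idempotent (Brauer, [atom_idempotent]), and [a R]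
    contains a minimal right ideal as soon as [a] is nonzero of finite rank
    ([finite_rank_atom]).  Hence an [f] in [a R] with [orth_sum f m] can be
    enlarged inside [a R] as long as [(1 - f) a R] contains a minimal right
    ideal ([orth_sum_extend]), and when [a] has finite rank this stops with
    [a R = f R] ([finite_rank_orth_sum]).

    If [rank a = n] and [rank (a r) = n] as well, then some [f] with
    [orth_sum f n] lies in [a r R], and it cannot be enlarged in [a R], so
    [a R = f R = a r R].  Writing [f = a b], the idempotent [b f a] generates
    the left ideal [R a], and the problem becomes: if [f] is a sum of
    orthogonal minimal idempotents and [f r s = f], then [f r = f x] for a
    unit [x].  This is cancellation of [f R] from direct sum decompositions
    of [R].  It is proved one idempotent [e] at a time, where it reduces to the
    fact that [e R e] is a division ring: an element [t] of [e R] with a right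
    inverse, seen as the row with entries [t e] and [t (1 - e)], is carried to
    [e] by column operations, i.e. by right multiplication by a unit
    ([atom_complete], [orth_sum_complete]).

    Conversely, let [a] satisfy the second condition and have rank greater
    than [n].  No [f] in [a R] satisfies [orth_sum f n]: it would have rank
    [n], hence be [a x] for a unit [x].  So some [g] in [a R] with
    [orth_sum g k] and [k < n] cannot be enlarged, and [(1 - g) a R] contains
    no minimal right ideal.  If [(1 - g) a] were nonzero, it would not have
    rank less than [n], so it would be [a x] for a unit [x]; thus [g a = 0]
    and [g = 0].  The same argument then shows that every nonzero [a r]
    generates [a R], i.e. that [a R] is minimal, a contradiction.  Therefore
    [a = g a] has rank at most [k]. *)

(** * Elements generating minimal right ideals *)

(** The right ideal [x R] is zero or minimal.  Including zero makes the notion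
    stable under multiplication on both sides. *)
Definition atom (R : pzRingType) (x : R) : Prop :=
  forall r, x * r <> 0 -> exists s, x * r * s = x.

Lemma atom_mull (R : pzRingType) (y x : R) : atom x -> atom (y * x).
Proof.
move=> ax r yxr; have [|s xrs] := ax r.
  by move=> xr; apply: yxr; rewrite -mulrA xr mulr0.
by exists s; rewrite -{2}xrs !mulrA.
Qed.

Lemma atom_mulr (R : pzRingType) (x y : R) : atom x -> atom (x * y).
Proof.
move=> ax r xyr; have [|s xrs] := ax (y * r); first by rewrite mulrA.
by exists (s * y); rewrite -{2}xrs !mulrA.
Qed.

Lemma minimal_right_ideal_atom (R : pzRingType) (I : set R) (x : R) :
  minimal_right_ideal I -> I x -> atom x.
Proof.
move=> [[I0 ID IM] _ Imin] Ix r xr.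
pose J := [set y | exists s, y = x * r * s]%classic.
have [||JE|JE] := Imin J.
- split; first by exists 0; rewrite mulr0.
  + by move=> _ _ [s ->] [t ->]; exists (s + t); rewrite mulrDr.
  + by move=> _ t [s ->]; exists (s * t); rewrite mulrA.
- by move=> _ [s ->]; rewrite -mulrA; exact: IM.
- by have : J (x * r); [exists 1; rewrite mulr1|rewrite JE].
- have : J x by rewrite JE.
  by move=> [s xE]; exists s.
Qed.

Lemma atom_minimal_right_ideal (R : pzRingType) (x : R) :
  atom x -> x <> 0 ->
  minimal_right_ideal [set y | exists r, y = x * r]%classic.
Proof.
move=> ax x0; split.
- split; first by exists 0; rewrite mulr0.
  + by move=> _ _ [s ->] [t ->]; exists (s + t); rewrite mulrDr.
  + by move=> _ t [s ->]; exists (s * t); rewrite mulrA.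
- move=> E; apply: x0.
  have : [set y | exists r, y = x * r]%classic x by exists 1; rewrite mulr1.
  by rewrite E.
- move=> J [J0 JD JM] Jx.
  have [sub|nsub] := pselect (J `<=` [set 0])%classic.
    by left; apply/seteqP; split=> // _ ->.
  right; apply/seteqP; split=> // _ [r ->].
  have [y [Jy y0]] : exists y, J y /\ y <> 0.
    by apply: contrapT => nex; apply: nsub => y Jy; apply: contrapT => y0;
       apply: nex; exists y.
  have [t yE] := Jx _ Jy; rewrite yE in Jy y0.
  by have [s <-] := ax _ y0; do 2!apply: (JM).
Qed.

(** Brauer's lemma.  Left multiplication by [w = x y] is injective on the
    minimal right ideal [x R] as soon as [w x] is nonzero, and the idempotent
    is the preimage of [w]. *)
Lemma atom_idempotent (R : pzRingType) (x : R) :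
  semiprime_ring R -> atom x -> x <> 0 ->
  exists2 t, x * t <> 0 & x * t * (x * t) = x * t.
Proof.
move=> sp ax x0.
have [y wx0] : exists y, x * y * x <> 0.
  by apply: contrapT => nex; apply/x0/sp => y; apply: contrapT => ne;
     apply: nex; exists y.
have [s wxs] : exists s, x * y * x * s = x.
  have [|s] := ax (y * x); first by rewrite mulrA.
  by rewrite mulrA; exists s.
have winj z : x * y * (x * z) = 0 -> x * z = 0.
  move=> wxz; apply: contrapT => /ax[u xzu].
  by apply: wx0; rewrite -(congr1 ( *%R (x * y)) xzu) mulrA wxz mul0r.
exists (s * y).
  move=> e0; apply: wx0; rewrite -{1}wxs -[_ * s * y]mulrA -[_ * (s * y)]mulrA.
  by rewrite e0 mulr0 mul0r.
apply/eqP; rewrite -subr_eq0; apply/eqP.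
rewrite -[x * (s * y) * _]mulrA -mulrBr; apply: winj.
by rewrite !mulrBr !mulrA !wxs subrr.
Qed.

(** * Ranks as lengths of sums of atoms *)

Definition atom_sum (R : pzRingType) (a : R) (k : nat) : Prop :=
  exists s : seq R,
    [/\ size s = k, forall x, x \in s -> atom x & a = \sum_(x <- s) x].

Lemma atom_sum_mull (R : pzRingType) (p a : R) k :
  atom_sum a k -> atom_sum (p * a) k.
Proof.
move=> [s [<- as_ ->]]; exists [seq p * x | x <- s].
rewrite size_map big_map mulr_sumr; split=> // _ /mapP[x /as_ ax ->].
exact: atom_mull.
Qed.

Lemma atom_sum_mulr (R : pzRingType) (a q : R) k :
  atom_sum a k -> atom_sum (a * q) k.
Proof.
move=> [s [<- as_ ->]]; exists [seq x * q | x <- s].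
rewrite size_map big_map mulr_suml; split=> // _ /mapP[x /as_ ax ->].
exact: atom_mulr.
Qed.

Lemma in_sum_atom_sum (R : pzRingType) (a : R) k :
  in_sum_of_minimal a k -> atom_sum a k.
Proof.
move=> [I Imin [u Iu ->]]; exists [seq u i | i <- enum 'I_k].
rewrite size_map size_enum_ord big_map big_enum; split=> // _ /mapP[i _ ->].
exact: minimal_right_ideal_atom (Imin i) (Iu i).
Qed.

Lemma atom_sum_rank (R : pzRingType) (a : R) k :
  atom_sum a k -> (rank a <= k%:Z%:E)%E.
Proof.
move=> [s [<- as_ ->]]; pose t := [seq x <- s | x != 0].
apply: (@le_trans _ _ ((size t)%:Z%:E)); last first.
  by rewrite lee_fin lez_nat size_filter count_size.
apply: right_rank_le.
have tP (i : 'I_(size t)) : atom t`_i /\ t`_i <> 0.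
  by have := mem_nth 0 (ltn_ord i); rewrite mem_filter => /andP[/eqP ? /as_].
exists (fun i : 'I_(size t) => [set y | exists r, y = t`_i * r]%classic).
  by move=> i; have [] := tP i; exact: atom_minimal_right_ideal.
exists (fun i : 'I_(size t) => t`_i).
  by move=> i; exists 1; rewrite mulr1.
transitivity (\sum_(x <- t) x); last by rewrite (big_nth 0) big_mkord.
rewrite big_filter (bigID (fun x => x == 0)) /= big1 ?add0r // => x.
by move=> /eqP.
Qed.

Lemma rank_atom_sum (R : pzRingType) (a : R) :
  rank a = +oo%E \/ exists2 k, rank a = k%:Z%:E & atom_sum a k.
Proof.
rewrite /rank /right_rank; case: pselect => [exk|_]; last by left.
right; case: ex_minnP => k /asboolP ak _; exists k => //.
exact: in_sum_atom_sum.
Qed.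

(** Some [a x u] with [u] one of the atoms summing to [a] is nonzero, because
    [a x a] is. *)
Lemma finite_rank_atom (R : pzRingType) (a : R) k :
  semiprime_ring R -> atom_sum a k -> a <> 0 ->
  exists2 t, atom (a * t) & a * t <> 0.
Proof.
move=> sp [s [_ as_ aE]] a0; apply: contrapT => nex; apply/a0/sp => x.
rewrite {2}aE mulr_sumr big_seq big1 // => u us.
apply: contrapT => axu; apply: nex; exists (x * u); last by rewrite mulrA.
by rewrite mulrA; apply/atom_mull/as_.
Qed.

(** * Orthogonal sums of minimal idempotents *)

Inductive orth_sum (R : pzRingType) : R -> nat -> Prop :=
| orth_sum0 : orth_sum 0 0
| orth_sumS f e m :
    orth_sum f m -> e * e = e -> e <> 0 -> atom e -> f * e = 0 -> e * f = 0 ->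
    orth_sum (f + e) m.+1.

Lemma orth_sum_idem (R : pzRingType) (f : R) m : orth_sum f m -> f * f = f.
Proof.
elim=> [|{}f e {}m _ ff ee _ _ fe ef]; first by rewrite mul0r.
by rewrite mulrDl !mulrDr ff ee fe ef addr0 add0r.
Qed.

Lemma orth_sum_atom_sum (R : pzRingType) (f : R) m :
  orth_sum f m -> atom_sum f m.
Proof.
elim=> [|{}f e {}m _ [s [<- as_ ->]] ee _ ae _ _].
  by exists [::]; rewrite big_nil.
exists (e :: s); rewrite big_cons addrC; split=> // x.
by rewrite inE => /orP[/eqP ->|/as_].
Qed.

(** Steinitz exchange: writing [f + e] as a sum of atoms, one of them, [x],
    satisfies [x e <> 0].  Since [x R = x e R], the contribution of [x] to [f]
    is a right multiple of its contribution to [e]; as [f e = 0], it can be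
    expressed through the remaining atoms. *)
Lemma orth_sum_le_rank (R : pzRingType) (f : R) m k :
  orth_sum f m -> atom_sum f k -> (m <= k)%N.
Proof.
move=> fm; elim: fm k => [//|{}f e {}m fm IH ee e0 ae fe ef] k [s [sk as_ fE]].
have ff := orth_sum_idem fm.
have sum_e : e = \sum_(x <- s) x * e.
  by rewrite -mulr_suml -fE mulrDl fe ee add0r.
have [x xs xe] : exists2 x, x \in s & x * e <> 0.
  apply: contrapT => nex; apply: e0; rewrite sum_e big_seq big1 // => x xs.
  by apply: contrapT => xe; apply: nex; exists x.
have [t xet] := as_ _ xs _ xe.
pose S := \sum_(y <- rem x s) y.
have xS : x + S = f + e by rewrite fE (big_rem x).
have fSe : f * S * e = - (f * x * e).
  apply/eqP; rewrite -addr_eq0 -mulrDl -mulrDr addrC xS.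
  by rewrite mulrDr ff fe addr0 fe.
have fE' : f * S * (f - e * t * f) = f.
  rewrite mulrBr !mulrA fSe !mulNr opprK -[f * x * e]mulrA -[f * _ * t]mulrA.
  by rewrite xet -mulrDl -mulrDr addrC xS mulrDr ff fe addr0 ff.
have: atom_sum f (size (rem x s)).
  rewrite -fE'; apply/atom_sum_mulr/atom_sum_mull.
  by exists (rem x s); split=> // y /mem_rem /as_.
by move=> /IH; rewrite size_rem // -sk; case: (s) xs.
Qed.

(** Conjugation by the mutually inverse isomorphisms between [f R] and
    [b f R] induced by [b] and [f a]. *)
Lemma orth_sum_conj (R : pzRingType) (f a b : R) m :
  orth_sum f m -> f * a * b = f -> orth_sum (b * f * a) m.
Proof.
elim=> [|{}f e {}m fm IH ee e0 ae fe ef] fab.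
  by rewrite mulr0 mul0r; exact: orth_sum0.
have ff := orth_sum_idem fm.
have fab' : f * a * b = f.
  by have := congr1 ( *%R f) fab; rewrite !mulrA mulrDr ff fe addr0.
have eab : e * a * b = e.
  by have := congr1 ( *%R e) fab; rewrite !mulrA mulrDr ee ef add0r.
have conjM x y : x * a * b = x -> b * x * a * (b * y * a) = b * (x * y) * a.
  by move=> xab; rewrite -{2}xab !mulrA.
rewrite mulrDr mulrDl; apply: orth_sumS; first exact: IH.
- by rewrite conjM // ee.
- move=> bea; apply: e0.
  have : e * a * (b * e * a) * b = 0 by rewrite bea mulr0 mul0r.
  by rewrite !mulrA eab ee eab.
- exact/atom_mulr/atom_mull.
- by rewrite conjM // fe mulr0 mul0r.
- by rewrite conjM // ef mulr0 mul0r.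
Qed.

(** Replacing an idempotent [h] in [(1 - g) a R] by [h (1 - g)] makes it
    orthogonal to [g] on both sides and keeps it in [a R]. *)
Lemma orth_sum_extend (R : pzRingType) (a b t : R) m :
  semiprime_ring R -> orth_sum (a * b) m ->
  atom ((1 - a * b) * a * t) -> (1 - a * b) * a * t <> 0 ->
  exists c, orth_sum (a * c) m.+1.
Proof.
move=> sp gm ax x0; have gg := orth_sum_idem gm.
have [u h0 hh] := atom_idempotent sp ax x0.
pose g := a * b; pose h := (1 - g) * a * t * u.
rewrite -/g -/h in gm gg h0 hh.
have gh : g * h = 0 by rewrite /h !mulrA mulrBr mulr1 gg subrr !mul0r.
have hE : h = a * ((1 - b * a) * t * u).
  by rewrite /h /g !mulrA mulrBl mulrBr mulr1 mul1r !mulrA.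
exists (b + (1 - b * a) * t * u * (1 - g)).
rewrite mulrDr -/g !mulrA -[a * _ * t]mulrA -[a * _ * u]mulrA -hE.
apply: orth_sumS => //.
- by rewrite mulrA -[h * (1 - g) * h]mulrA mulrBl mul1r gh subr0 hh.
- move=> h'0; apply: h0; rewrite -hh.
  by have := congr1 ( *%R^~ h) h'0; rewrite mul0r -mulrA mulrBl mul1r gh subr0.
- by apply: atom_mulr; rewrite /h; apply: atom_mulr.
- by rewrite mulrA gh mul0r.
- by rewrite -mulrA mulrBl mul1r gg subrr mulr0.
Qed.

(** Inside [a R] an orthogonal sum of minimal idempotents has at most [rank a]
    terms, and it can be extended until it generates [a R]. *)
Lemma finite_rank_orth_sum (R : pzRingType) (a : R) k :
  semiprime_ring R -> atom_sum a k ->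
  exists b m, orth_sum (a * b) m /\ a * b * a = a.
Proof.
move=> sp ak; pose attained m := exists b, orth_sum (a * b) m.
have bound m : attained m -> (m <= k)%N.
  by move=> [b bm]; apply: orth_sum_le_rank bm _; exact: atom_sum_mulr.
have [m [[b bm] mmax]] : exists m, attained m /\ ~ attained m.+1.
  apply: contrapT => nex; have : attained k.+1; last first.
    by move=> /bound; rewrite ltnn.
  elim: k.+1 => [|m mP]; first by exists 0; rewrite mulr0; exact: orth_sum0.
  by apply: contrapT => mP'; apply: nex; exists m.
exists b, m; split=> //; apply/esym/eqP; rewrite -subr_eq0 -{1}[a]mul1r -mulrBl.
apply/eqP; apply: contrapT => a'0.
have [t ax x0] := finite_rank_atom sp (atom_sum_mull (1 - a * b) ak) a'0.
by apply: mmax; exact: orth_sum_extend sp bm ax x0.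
Qed.

(** * Completing one-sided inverses to units *)

Lemma unitsM (R : pzRingType) (x y : R) :
  units R x -> units R y -> units R (x * y).
Proof.
move=> [x' [xx' x'x]] [y' [yy' y'y]]; exists (y' * x'); split.
  by rewrite mulrA -[x * y * y']mulrA yy' mulr1.
by rewrite mulrA -[y' * x' * x]mulrA x'x mulr1.
Qed.

Lemma units_1D_sqr0 (R : pzRingType) (p : R) : p * p = 0 -> units R (1 + p).
Proof.
move=> pp; exists (1 - p); split.
  by rewrite mulrDl mul1r mulrBr mulr1 pp subr0 subrK.
by rewrite mulrBl mul1r mulrDr mulr1 pp addr0 addrK.
Qed.

(** By Schur's lemma [e R e] is a division ring; the inverse of [c] in it is
    completed by [1 - e] to an inverse in [R]. *)
Lemma units_corner (R : pzRingType) (e c : R) :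
  e * e = e -> atom e -> e * c = c -> c * e = c -> c <> 0 ->
  units R (1 - e + c).
Proof.
move=> ee ae ec ce c0.
have [s] : exists s, e * c * s = e by apply: ae; rewrite ec.
rewrite ec => cs; pose v := e * s * e.
have cv : c * v = e by rewrite /v !mulrA ce cs ee.
have ev : e * v = v by rewrite /v !mulrA ee.
have ve : v * e = v by rewrite /v -mulrA ee.
have v0 : v <> 0 by move=> v0; apply: c0; rewrite -ec -cv v0 mulr0 mul0r.
have [t] : exists t, e * v * t = e by apply: ae; rewrite ev.
rewrite ev => vt.
have vc : v * c = e.
  have cE : c = e * t by rewrite -{1}ce -{1}vt mulrA cv.
  by rewrite cE mulrA ve vt.
have inv x y : e * y = y -> x * e = x -> x * y = e ->
    (1 - e + x) * (1 - e + y) = 1.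
  move=> ey xe xy; rewrite mulrDl mulrBl mul1r !mulrDr !mulrN !mulr1.
  by rewrite ee ey xe xy !subrr !add0r addrK subrK.
by exists (1 - e + v); split; apply: inv.
Qed.

(** The elements [t] of [e R] are rows with entries [t e] and [t (1 - e)].
    If [t e] is nonzero, it is a unit of [e R e], and it is normalised to [e]
    before [t (1 - e)] is cleared; if [t e = 0], the right inverse [s] of [t]
    is used to create the entry [e].  All the units involved fix [g], which
    stands for the part of the idempotent that has already been treated. *)
Lemma atom_complete (R : pzRingType) (g e t s : R) :
  g * g = g -> e * e = e -> atom e -> g * e = 0 -> e * g = 0 ->
  e * t = t -> t * g = 0 -> t * s * e = e ->
  exists x, [/\ units R x, e * x = t & g * x = g].
Proof.
move=> gg ee ae ge eg et tg tse.
have gt : g * t = 0 by rewrite -et mulrA ge mul0r.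
have [te|te] := pselect (t * e = 0).
  pose q := (1 - g - e) * s * e.
  have eq0 : e * q = 0.
    by rewrite /q !mulrA !mulrBr mulr1 eg ee subr0 subrr !mul0r.
  have gq : g * q = 0.
    by rewrite /q !mulrA !mulrBr mulr1 gg ge subrr subr0 !mul0r.
  have tq : t * q = e.
    by rewrite /q !mulrA !mulrBr mulr1 tg te !subr0.
  exists ((1 + t) * (1 - q)); split.
  - apply: unitsM; apply: units_1D_sqr0; first by rewrite -{2}et mulrA te mul0r.
    by rewrite mulrNN -[LHS]/((1 - g - e) * s * e * q) -mulrA eq0 mulr0.
  - rewrite mulrA [e * (1 + t)]mulrDr mulr1 et mulrBr mulr1 mulrDl eq0 add0r tq.
    by rewrite addrAC subrr add0r.
  - by rewrite mulrA [g * (1 + t)]mulrDr mulr1 gt addr0 mulrBr mulr1 gq subr0.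
pose p := t * (1 - e).
have pt : p * t = 0 by rewrite /p -mulrA mulrBl mul1r et subrr mulr0.
have pe : p * e = 0 by rewrite /p -mulrA mulrBl mul1r ee subrr mulr0.
have ep : e * p = p by rewrite /p mulrA et.
exists ((1 + p) * (1 - e + t * e)); split.
- apply: unitsM; first by apply: units_1D_sqr0; rewrite {2}/p mulrA pt mul0r.
  by apply: units_corner; rewrite ?mulrA ?et // -mulrA ee.
- rewrite mulrA [e * (1 + p)]mulrDr mulr1 ep mulrDl !mulrDr !mulrN !mulr1.
  by rewrite ee subrr add0r mulrA et pe subr0 mulrA pt mul0r addr0
     /p mulrBr mulr1 addrC subrK.
- rewrite mulrA [g * (1 + p)]mulrDr mulr1 /p mulrA gt mul0r addr0.
  by rewrite mulrDr mulrBr mulr1 ge subr0 mulrA gt mul0r addr0.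
Qed.

(** Cancellation of the finite length summand [f R] from [R], in coordinates:
    left multiplication by [f r] is a split epimorphism from [R] onto [f R],
    and an automorphism of [R] carries it to the projection by [f]. *)
Lemma orth_sum_complete (R : pzRingType) (f r s : R) m :
  orth_sum f m -> f * r * s = f -> exists2 x, units R x & f * x = f * r.
Proof.
move=> fm; elim: fm r s => [|{}f e {}m fm IH ee e0 ae fe ef] r s frs.
  by exists 1; rewrite ?mul0r //; exists 1; rewrite mulr1.
have ff := orth_sum_idem fm.
have frs' : f * r * s = f.
  by have := congr1 ( *%R f) frs; rewrite !mulrA mulrDr ff fe addr0.
have ers : e * r * s = e.
  by have := congr1 ( *%R e) frs; rewrite !mulrA mulrDr ee ef add0r.
have [x1 [y1 [xy1 yx1]] fx1] := IH _ _ frs'.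
pose r1 := r * y1; pose s1 := x1 * s.
have rs1 : r1 * s1 = r * s.
  by rewrite /r1 /s1 mulrA -[r * y1 * x1]mulrA yx1 mulr1.
have fr1 : f * r1 = f by rewrite /r1 mulrA -fx1 -mulrA xy1 mulr1.
have fs1 : f * s1 = f by rewrite -{1}fr1 -mulrA rs1 mulrA frs'.
have r1x1 : r1 * x1 = r by rewrite /r1 -mulrA yx1 mulr1.
clearbody r1 s1.
have [|||x2 [ux2 ex2 fx2]] :=
    @atom_complete R f e (e * r1 * (1 - f)) s1 ff ee ae fe ef.
- by rewrite !mulrA ee.
- by rewrite -mulrA mulrBl mul1r ff subrr mulr0.
- rewrite -[_ * (1 - f) * s1]mulrA [(1 - f) * s1]mulrBl mul1r fs1 mulrBr mulrBl.
  rewrite -[e * r1 * f * e]mulrA fe mulr0 subr0.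
  by rewrite -[e * r1 * s1]mulrA rs1 mulrA ers ee.
pose z := e * r1 * f.
have zz : z * z = 0 by rewrite /z !mulrA -[e * r1 * f * e]mulrA fe mulr0 !mul0r.
exists ((1 + z) * x2 * x1).
  by apply: unitsM; [apply: unitsM => //; exact: units_1D_sqr0|exists y1].
rewrite !mulrA [(f + e) * (1 + z)]mulrDr mulr1 [(f + e) * z]mulrDl.
rewrite {1 2}/z !mulrA fe !mul0r add0r ee.
rewrite !mulrDl fx2 ex2.
rewrite -[e * r1 * f * x2]mulrA fx2 -addrA -[in LHS]mulrDl -mulrDr.
rewrite subrK mulr1 fx1.
by rewrite -mulrA r1x1.
Qed.

(** * The characterisation of the rank *)

Theorem corollary4p11 (R : pzRingType) (hR : semiprime_ring R) (n : nat)
    (a : R) :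
  rank a = (n%:Z)%:E <->
  ((n%:Z - 1)%:E < rank a)%E /\
  (forall r : R,
      (rank (a * r) < (n%:Z)%:E)%E \/
      (exists2 x : R, units R x & a * r = a * x)).
Proof.
have atom_sum_lt (b : R) k : atom_sum b k -> (k < n)%N -> (rank b < n%:Z%:E)%E.
  by move=> /atom_sum_rank bk kn; apply: le_lt_trans bk _;
     rewrite lte_fin ltz_nat.
have lt_atom_sum (b : R) :
    (rank b < n%:Z%:E)%E -> exists2 k, (k < n)%N & atom_sum b k.
  have [->|[k -> bk]] := rank_atom_sum b; first by rewrite ltNge leey.
  by rewrite lte_fin ltz_nat; exists k.
split=> [an|[an1 aP]].
  have an' : atom_sum a n.
    have [|[k]] := rank_atom_sum a; first by rewrite an.
    by rewrite an => -[<-].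
  split=> [|r]; first by rewrite an lte_fin ltrBlDr ltrDl.
  have [|arn] := pselect (rank (a * r) < n%:Z%:E)%E; [by left|right].
  have [c [m [fm arE]]] := finite_rank_orth_sum hR (atom_sum_mulr r an').
  rewrite -[a * r * c]mulrA in fm arE; move bE: (r * c) fm arE => b fm arE.
  have nm : (n <= m)%N.
    rewrite leqNgt; apply/negP => mn; apply: arn; rewrite -arE.
    exact: atom_sum_lt (atom_sum_mulr _ (orth_sum_atom_sum fm)) mn.
  have aE : a * b * a = a.
    apply/esym/eqP; rewrite -subr_eq0 -{1}[a]mul1r -mulrBl; apply/eqP.
    apply: contrapT => a'0.
    have [t ax x0] := finite_rank_atom hR (atom_sum_mull (1 - a * b) an') a'0.
    have [d dm] := orth_sum_extend hR fm ax x0.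
    have := orth_sum_le_rank dm (atom_sum_mulr d an').
    by rewrite ltnNge nm.
  have fab : a * b * a * b = a * b by rewrite aE.
  have fm' := orth_sum_conj fm fab.
  (* [b f a] generates the left ideal [R a]. *)
  have fE : a * (b * (a * b) * a) = a by rewrite !mulrA aE aE.
  have [|x ux fx] := @orth_sum_complete _ _ r (c * a) _ fm'.
    have -> : b * (a * b) * a * r * (c * a) = b * (a * b) * (a * b * a).
      by rewrite -bE !mulrA.
    by rewrite aE.
  by exists x => //; rewrite -[in RHS]fE -[RHS]mulrA fx mulrA fE.
apply: contrapT => an.
have rank_gt k : (k <= n)%N -> ~ atom_sum a k.
  move=> kn /atom_sum_rank ak; apply: an; apply/eqP; rewrite eq_le.
  rewrite (le_trans ak) ?lee_fin ?lez_nat //=.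
  move: an1; have [->|[j -> _]] := rank_atom_sum a; first by rewrite leey.
  by rewrite lte_fin lee_fin ltrBlDr ltzD1.
pose attained k := exists b, orth_sum (a * b) k.
have not_attained_n : ~ attained n.
  move=> [b bn].
  have [/lt_atom_sum[k kn bk]|[x [y [xy _]] abx]] := aP b.
    by have := orth_sum_le_rank bn bk; rewrite leqNgt kn.
  have aE : a = a * b * y by rewrite abx -mulrA xy mulr1.
  by apply: (rank_gt n) => //; rewrite aE; apply/atom_sum_mulr/orth_sum_atom_sum.
have [k [kn [b bk] kmax]] :
    exists k, [/\ (k < n)%N, attained k & ~ attained k.+1].
  apply: contrapT => nex; apply: not_attained_n.
  have: forall k, (k <= n)%N -> attained k; last exact.
  elim=> [|k IH] kn; first by exists 0; rewrite mulr0; exact: orth_sum0.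
  by apply: contrapT => nk; apply: nex; exists k; split=> //; apply/IH/ltnW.
have gg := orth_sum_idem bk.
(* By maximality of [k], an element of [(1 - g) a R] that is not zero has rank
   at least [n], hence is a unit multiple of [a]. *)
have zero_or_assoc (r : R) : (1 - a * b) * a * r = 0 \/
    exists2 x, units R x & (1 - a * b) * a * r = a * x.
  have yE : (1 - a * b) * a * r = a * ((1 - b * a) * r).
    by rewrite mulrBl mul1r mulrA mulrBr mulr1 mulrA.
  have [/lt_atom_sum[j _]|[x ux yx]] := aP ((1 - b * a) * r); last first.
    by right; exists x; rewrite // yE.
  rewrite -yE => yj; left; apply: contrapT => y0.
  have [t ax x0] := finite_rank_atom hR yj y0; apply: kmax.
  by rewrite -[_ * r * t]mulrA in ax x0; exact: orth_sum_extend hR bk ax x0.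
have [a'0|a'0] := pselect ((1 - a * b) * a = 0).
  apply: (rank_gt k); first exact: ltnW.
  move/eqP: a'0; rewrite mulrBl mul1r subr_eq0 => /eqP ->.
  exact/atom_sum_mulr/orth_sum_atom_sum.
have g0 : a * b = 0.
  have [|[x [y [xy _]]]] := zero_or_assoc 1; rewrite mulr1 // => a'x.
  have aE : a = (1 - a * b) * a * y by rewrite a'x -mulrA xy mulr1.
  by rewrite -gg {2}aE !mulrA mulrBr mulr1 gg subrr !mul0r.
have aE : (1 - a * b) * a * 1 = a by rewrite g0 subr0 mul1r mulr1.
apply: kmax; apply: (orth_sum_extend (t := 1)) hR bk _ _.
  rewrite aE => r ar0; have [|[x [y [xy _]]]] := zero_or_assoc r.
    by rewrite g0 subr0 mul1r.
  by rewrite g0 subr0 mul1r => ->; exists y; rewrite -mulrA xy mulr1.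
by rewrite mulr1.
Qed.
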